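(* Let $V$ be a nonempty finite set and let $A, B \subseteq V\times V$ be directed graphs on the vertex set $V$ such that $A\cap B^T = I$ and $A\cup B^T = V\times V$. Let $\omega: V\to \mathbb{R}_{\geq 0}$ be a weight function. Then there is a vertex $v\in V$ such that $$\omega\big((AB\cup BA)(v)\big)\;\geq\; \omega(A(v))+\omega(B(v))-\omega(v).$$
   Context: All graphs are finite. A directed graph (digraph) on a vertex set $V$ is identified with its edge set, a subset of $V\times V$ (self-loops are allowed, parallel edges are not), so set operations apply to digraphs on the same vertex set. Notation for digraphs $A,B\subseteq V\times V$: $I=\{(v,v)\mid v\in V\}$ is the identity graph; $A^T=\{(u,v)\mid (v,u)\in A\}$ is the transpose of $A$; the product graph is $AB=\{(u,v)\mid \exists w\in V,\ (u,w)\in A \text{ and } (w,v)\in B\}$; for $v\in V$, $A(v)=\{u\in V\mid (v,u)\in A\}$. For $\omega:V\to\mathbb{R}_{\geq 0}$ and $S\subseteq V$, $\omega(S)=\sum_{u\in S}\omega(u)$. *)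

(* Defs.v *)
From mathcomp Require Import all_boot all_order all_algebra.
From mathcomp Require Import reals.

Set Implicit Arguments.
Unset Strict Implicit.
Unset Printing Implicit Defensive.

Import Order.TTheory GRing.Theory Num.Theory.
Local Open Scope ring_scope.

(* A digraph on V is its edge set: self-loops allowed, no parallel edges. *)
Notation digraph V := {set V * V}.

Definition dg_id (V : finType) : digraph V := [set (v, v) | v : V].

Definition dg_tr (V : finType) (A : digraph V) : digraph V :=
  [set e : V * V | (e.2, e.1) \in A].

Definition dg_mul (V : finType) (A B : digraph V) : digraph V :=
  [set e : V * V | [exists w : V, ((e.1, w) \in A) && ((w, e.2) \in B)]].

Definition dg_out (V : finType) (A : digraph V) (v : V) : {set V} :=
  [set u : V | (v, u) \in A].

Definition weight (R : realType) (V : finType) (omega : V -> R) (S : {set V}) : R :=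
  \sum_(u in S) omega u.

(* Main.v *)
Require Import Defs.
From mathcomp Require Import all_boot all_order all_algebra.
From mathcomp Require Import boolp reals.
From mathcomp Require Import ring lra.

(** The hypotheses say that [A] is reflexive and that, for [v] different from
    [w], [B] has the edge [(v, w)] exactly when [A] lacks [(w, v)].  When [A] is
    a reflexive tournament this forces [B = A], and the theorem is the weighted
    form of Seymour's second neighbourhood conjecture for tournaments (Dean's
    conjecture).  The argument extends Fisher's proof of that case: the vertex
    is found by averaging over an equilibrium of a symmetric zero-sum game.

    The payoff matrix [M u v = [(u, v) \in A] - [(v, u) \in A]] is
    skew-symmetric, so the game has value zero and there is a nonzero [p >= 0]
    with [M p >= 0] ([skew_equilibrium], a consequence of Farkas' lemma).
    Multiplying the gap between the two sides of the theorem at [v] by [p v],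
    summing over [v] and exchanging sums ([sum_weight_out]), it is enough to
    prove for each [w] an inequality between [p]-masses of in-neighbourhoods.
    With [C = AB \cup BA] and [B] written in terms of [A], that inequality is
      [p {v | (v, w) \notin C} <= (M p) w].

    A vertex [v] has no [C]-edge to [w] exactly when every out-neighbour of [v]
    is an out-neighbour of [w] other than [w], and every in-neighbour of [w] is
    an in-neighbour of [v] other than [v].  So, as strategies, all such [v] are
    dominated by [w], and [w] beats each of them outright: [M w v = 1].  The
    mass an equilibrium puts on strategies dominated in this way is bounded by
    the payoff of [w] ([equilibrium_dominated]): playing [w] instead of
    a random dominated strategy, which earns zero, gains at least the mass of
    the dominated ones. *)

Set Implicit Arguments.
Unset Strict Implicit.
Unset Printing Implicit Defensive.

Import Order.TTheory GRing.Theory Num.Theory.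
Local Open Scope ring_scope.

(** Bartl's proof of Farkas' lemma, by induction on the number of forms.  If
    the last form [a k] is needed for the implication, a point [x0] where the
    other forms are nonpositive and [b] is positive has [a k x0 > 0].
    Projecting along [x0] onto the kernel of [a k] yields forms that satisfy
    the implication without [a k], and the coefficient of [a k] recovered from
    the projected identity is positive by the choice of [x0].  The duplicate-free
    [s] allows the coefficient at [k] to be changed independently. *)
Lemma farkas (R : realFieldType) (W : lmodType R) (I : eqType)
    (a : I -> W -> R) (b : W -> R) (s : seq I) :
  uniq s -> (forall i, scalar (a i)) -> scalar b ->
  (forall x, (forall i, i \in s -> a i x <= 0) -> b x <= 0) ->
  exists2 l : I -> R, forall i, 0 <= l i
    & forall x, b x = \sum_(i <- s) l i * a i x.
Proof.
elim: s a b => [|k s IHs] a b /=.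
  move=> _ _ b_lin b_le0; exists (fun=> 0) => // x; rewrite big_nil.
  have bx_le0 : b x <= 0 by exact: b_le0.
  (* The condition is vacuous, so [b] is nonpositive at [x] and at [- x]. *)
  have bNx_le0 : b ((-2) *: x + x) <= 0 by exact: b_le0.
  by rewrite b_lin in bNx_le0; lra.
case/andP=> k_s s_uniq a_lin b_lin b_le0.
have [b_le0_s | /existsNP[x0 /not_implyP[ax0 /negP]]] :=
  pselect (forall x, (forall i, i \in s -> a i x <= 0) -> b x <= 0).
  have [l l_ge0 bE] := IHs a b s_uniq a_lin b_lin b_le0_s.
  exists (fun i => if i == k then 0 else l i) => [i|x]; first by case: eqP.
  rewrite big_cons eqxx mul0r add0r bE; apply: eq_big_seq => i i_s.
  by case: eqP => // eq_ik; rewrite -eq_ik i_s in k_s.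
rewrite -ltNge => bx0_gt0.
have akx0_gt0 : 0 < a k x0.
  rewrite ltNge; apply/negP => akx0_le0.
  have /b_le0 : forall i, i \in k :: s -> a i x0 <= 0.
    by move=> i; rewrite inE => /predU1P[-> | /ax0].
  by rewrite leNgt bx0_gt0.
pose c x := a k x / a k x0.
have projE (f : W -> R) x :
    scalar f -> f (- c x *: x0 + x) = f x - c x * f x0.
  by move=> f_lin; rewrite f_lin mulNr addrC.
have proj_lin (f : W -> R) : scalar f -> scalar (fun x => f x - c x * f x0).
  by move=> f_lin t x y; rewrite /c f_lin (a_lin k); ring.
have [||x ax_le0|l l_ge0 bE] := IHs (fun i x => a i x - c x * a i x0)
  (fun x => b x - c x * b x0) s_uniq.
- by move=> i; exact: proj_lin.
- exact: proj_lin.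
- rewrite -projE//; apply: b_le0 => i; rewrite inE projE// => /predU1P[->|].
    by rewrite /c divfK ?subrr// gt_eqF.
  exact: ax_le0.
pose lk := (b x0 - \sum_(i <- s) l i * a i x0) / a k x0.
have lk_ge0 : 0 <= lk.
  rewrite divr_ge0 ?(ltW akx0_gt0)// subr_ge0 (le_trans _ (ltW bx0_gt0))//.
  rewrite big_seq; apply: sumr_le0 => i i_s.
  by rewrite mulr_ge0_le0// ax0.
exists (fun i => if i == k then lk else l i) => [i|x]; first by case: eqP.
rewrite big_cons eqxx.
under eq_big_seq => i i_s.
  rewrite ifN; last by apply: contraNneq k_s => <-.
  over.
rewrite -[b x](subrK (c x * b x0)) bE.
rewrite (eq_bigr (fun i => l i * a i x - c x * (l i * a i x0))) => [|i _]; last first.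
  by rewrite mulrBr [l i * (c x * _)]mulrCA.
by rewrite sumrB -mulr_sumr /lk /c; ring.
Qed.

(** A skew-symmetric form vanishes on the diagonal, here at the restriction of
    [p] to [Z]: a strategy earns nothing against itself. *)
Lemma skew_sum0 (R : realFieldType) (V : finType) (M : V -> V -> R)
    (p : V -> R) (Z : {set V}) :
  (forall u v, M u v = - M v u) ->
  \sum_(u in Z) p u * (\sum_(v in Z) M u v * p v) = 0.
Proof.
move=> M_skew; set S := LHS.
suff : S = - S by lra.
rewrite /S; under eq_bigr do rewrite mulr_sumr.
rewrite {1}exchange_big -sumrN; apply: eq_bigr => u _.
rewrite -sumrN; apply: eq_bigr => v _.
by rewrite (M_skew v u); ring.
Qed.

(** Apply [farkas] to the implication that [x >= 0] and [M x >= 0] force the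
    sum of the [x v] to be nonpositive.  If it fails, a counterexample is the
    desired [p].  If it holds, the multipliers [l] of the constraints
    [M x >= 0] satisfy [M l >= 1], since transposing [M] only changes its sign;
    so [l] is itself the desired [p]. *)
Lemma skew_equilibrium (R : realFieldType) (V : finType) (M : V -> V -> R) :
  (0 < #|V|)%N -> (forall u v, M u v = - M v u) ->
  exists p : V -> R, [/\ forall v, 0 <= p v, 0 < \sum_v p v
    & forall w, 0 <= \sum_v M w v * p v].
Proof.
move=> /card_gt0P[v0 _] M_skew.
pose a (i : V + V) (x : {ffun V -> R^o}) : R :=
  match i with inl v => - x v | inr w => - \sum_v M w v * x v end.
pose b (x : {ffun V -> R^o}) : R := \sum_v x v.
have a_lin i : scalar (a i).
  case: i => i t x y /=; first by rewrite !ffunE /GRing.scale/=; ring.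
  rewrite mulrN -opprD; congr (- _); rewrite mulr_sumr -big_split/=.
  by apply: eq_bigr => v _; rewrite !ffunE /GRing.scale/=; ring.
have b_lin : scalar b.
  move=> t x y; rewrite /b mulr_sumr -big_split/=.
  by apply: eq_bigr => v _; rewrite !ffunE.
have [b_le0|/existsNP[x /not_implyP[ax_le0 /negP]]] := pselect (forall x,
    (forall i, i \in index_enum (V + V)%type -> a i x <= 0) -> b x <= 0).
  have [l l_ge0 bE] := farkas (index_enum_uniq _) a_lin b_lin b_le0.
  (* Compare the coefficients of [x w] on both sides of [bE]. *)
  have Ml_ge1 w : 1 <= \sum_v M w v * l (inr v).
    have := bE [ffun v => (v == w)%:R]; rewrite /b big_sumType/=.
    rewrite (bigD1 w)//= ffunE eqxx mulr1n big1 => [|v /negPf vw]; last by rewrite ffunE vw.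
    rewrite (bigD1 w)//= ffunE eqxx mulr1n big1 => [|v /negPf vw]; last first.
      by rewrite ffunE vw oppr0 mulr0.
    have -> : \sum_u l (inr u) * - (\sum_v M u v * [ffun v0 => (v0 == w)%:R : R^o] v)
        = \sum_v M w v * l (inr v).
      apply: eq_bigr => u _; rewrite (bigD1 w)//= ffunE eqxx mulr1n big1 => [|v /negPf vw].
        by rewrite (M_skew w u); ring.
      by rewrite ffunE vw mulr0.
    by have := l_ge0 (inl w); lra.
  exists (fun v => l (inr v)); split=> // [|w].
    rewrite lt_neqAle sumr_ge0// andbT eq_sym; apply/eqP => /psumr_eq0P l0.
    have := Ml_ge1 v0; rewrite big1 ?ler10// => v _.
    by rewrite l0 ?mulr0.
  exact: le_trans (Ml_ge1 w).
rewrite -ltNge => bx_gt0; exists x; split=> // [v|w].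
  by have := ax_le0 (inl v) (mem_index_enum _); rewrite oppr_le0.
by have := ax_le0 (inr w) (mem_index_enum _); rewrite oppr_le0.
Qed.

(** Complementary slackness: the products are nonnegative and add up to zero,
    hence every strategy in the support of [p] earns exactly zero. *)
Lemma equilibrium_slack (R : realFieldType) (V : finType) (M : V -> V -> R)
    (p : V -> R) :
  (forall u v, M u v = - M v u) -> (forall v, 0 <= p v) ->
  (forall w, 0 <= \sum_v M w v * p v) ->
  forall w, p w * \sum_v M w v * p v = 0.
Proof.
move=> M_skew p_ge0 Mp_ge0 w.
have /psumr_eq0P : \sum_w p w * \sum_v M w v * p v = 0.
  rewrite -[RHS](skew_sum0 p [set: V] M_skew) [RHS](eq_bigl predT) => [|u].
    apply: eq_bigr => u _; congr (_ * _).
    by apply: eq_bigl => v; rewrite inE.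
  by rewrite inE.
by apply=> // u _; rewrite mulr_ge0.
Qed.

(** By [equilibrium_slack], multiplying [(M p) w] by the mass of [Z] gives the
    [p]-weighted sum over [z \in Z] of [(M p) w - (M p) z].  Dominance discards the
    columns outside [Z], and a column [x \in Z] contributes at least
    [(1 - M z x) p x].  In the weighted sum, the terms in [M z x] cancel by skew
    symmetry and the square of the mass of [Z] remains. *)
Lemma equilibrium_dominated (R : realFieldType) (V : finType)
    (M : V -> V -> R) (p : V -> R) (w : V) (Z : {set V}) :
  (forall u v, M u v = - M v u) -> (forall v, 0 <= p v) ->
  (forall w, 0 <= \sum_v M w v * p v) ->
  (forall z x, z \in Z -> M z x <= M w x) ->
  (forall z, z \in Z -> 1 <= M w z) ->
  \sum_(z in Z) p z <= \sum_v M w v * p v.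
Proof.
move=> M_skew p_ge0 Mp_ge0 domZ winZ.
have [-> //|pZ_gt0] : \sum_(z in Z) p z = 0 \/ 0 < \sum_(z in Z) p z.
  by apply/predU1P; rewrite eq_sym -le_eqVlt sumr_ge0.
rewrite -(ler_pM2l pZ_gt0).
have -> : (\sum_(z in Z) p z) * (\sum_v M w v * p v)
    = \sum_(z in Z) p z * \sum_x (M w x - M z x) * p x.
  rewrite mulr_suml; apply: eq_bigr => z _.
  under [in RHS]eq_bigr do rewrite mulrBl.
  by rewrite sumrB mulrBr (equilibrium_slack M_skew p_ge0 Mp_ge0 z) subr0.
have -> : (\sum_(z in Z) p z) * (\sum_(z in Z) p z)
    = \sum_(z in Z) p z * \sum_(x in Z) (1 - M z x) * p x.
  apply/eqP; rewrite mulr_suml -subr_eq0 -sumrB; apply/eqP.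
  rewrite -[RHS](skew_sum0 p Z M_skew).
  apply: eq_bigr => z _; rewrite -mulrBr -sumrB; congr (_ * _).
  by apply: eq_bigr => x _; ring.
apply: ler_sum => z zZ; apply: ler_wpM2l => //.
rewrite [leRHS](bigID (mem Z))/= -[leLHS]addr0 lerD//.
  by apply: ler_sum => x xZ; rewrite ler_wpM2r// lerB// winZ.
by apply: sumr_ge0 => x _; rewrite mulr_ge0// subr_ge0 domZ.
Qed.

Lemma sum_weight_out (R : realType) (V : finType) (p omega : V -> R)
    (D : digraph V) :
  \sum_v p v * weight omega (dg_out D v)
    = \sum_w omega w * \sum_v p v * ((v, w) \in D)%:R.
Proof.
under eq_bigr do rewrite /weight big_mkcond mulr_sumr.
rewrite exchange_big; apply: eq_bigr => w _; rewrite mulr_sumr.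
by apply: eq_bigr => v _; rewrite inE; case: ifP => _ /=; ring.
Qed.

Lemma exists_ge0_of_weighted_sum (R : realFieldType) (V : finType)
    (p g : V -> R) :
  (forall v, 0 <= p v) -> 0 < \sum_v p v -> 0 <= \sum_v p v * g v ->
  exists v, 0 <= g v.
Proof.
move=> p_ge0 p_gt0 pg_ge0; apply/existsP; apply: contraLR pg_ge0.
rewrite negb_exists -ltNge => /forallP g_lt0.
have {}g_lt0 v : g v < 0 by rewrite ltNge g_lt0.
have [v /andP[_ pv_gt0]] : exists v : V, true && (0 < p v).
  by apply: psumr_neq0P => //; apply/eqP; rewrite gt_eqF.
rewrite (bigD1 v)//= -[ltRHS]addr0 ltr_leD ?pmulr_rlt0//.
by apply: sumr_le0 => u _; rewrite mulr_ge0_le0// ltW.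
Qed.

Theorem theorem5 (R : realType) (V : finType) (A B : digraph V) (omega : V -> R)
    (V_nonempty : (0 < #|V|)%N)
    (AB_cap : A :&: dg_tr B = dg_id V)
    (AB_cup : A :|: dg_tr B = [set: V * V])
    (omega_ge0 : forall v : V, 0 <= omega v) :
  exists v : V,
    weight omega (dg_out (dg_mul A B :|: dg_mul B A) v)
      >= weight omega (dg_out A v) + weight omega (dg_out B v) - omega v.
Proof.
have idE u v : ((u, v) \in dg_id V) = (u == v).
  by apply/imsetP/eqP => [[x _ [-> ->]] // | ->]; exists v.
have BE u v : ((u, v) \in B) = (u == v) || ((v, u) \notin A).
  have := congr1 (fun S : digraph V => (v, u) \in S) AB_cap.
  have := congr1 (fun S : digraph V => (v, u) \in S) AB_cup.
  rewrite /= !inE idE /= eq_sym.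
  by case: (_ == _); case: (_ \in A); case: (_ \in B).
have A_refl v : (v, v) \in A.
  have := congr1 (fun S : digraph V => (v, v) \in S) AB_cap.
  by rewrite /= inE idE eqxx => /andP[].
set C := dg_mul A B :|: dg_mul B A.
pose M u v : R := ((u, v) \in A)%:R - ((v, u) \in A)%:R.
have M_skew u v : M u v = - M v u by rewrite /M opprB.
have [p [p_ge0 p_gt0 Mp_ge0]] := skew_equilibrium V_nonempty M_skew.
(* Negating the two relational products, with [BE] turning a missing [B]-edge
   into an [A]-edge in the opposite direction. *)
have out_sub v w x : (v, w) \notin C -> (v, x) \in A -> ((w, x) \in A) && (x != w).
  rewrite !inE negb_or => /andP[/existsPn/(_ x) + _] /= => + vx.
  by rewrite vx BE/= negb_or negbK andbC.
have in_sub v w x : (v, w) \notin C -> (x, w) \in A -> ((x, v) \in A) && (x != v).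
  rewrite !inE negb_or => /andP[_ /existsPn/(_ x)] /= => + xw.
  by rewrite xw andbT BE/= negb_or negbK andbC eq_sym.
have nonC_mass w : \sum_(v | (v, w) \notin C) p v <= \sum_v M w v * p v.
  have := @equilibrium_dominated _ _ M p w [set v | (v, w) \notin C] M_skew p_ge0 Mp_ge0.
  under eq_bigl do rewrite inE.
  apply=> [z x|z]; rewrite inE => zC.
    apply: lerB; rewrite ler_nat.
      by case: (boolP ((z, x) \in A)) => // /(out_sub _ _ _ zC)/andP[->].
    by case: (boolP ((x, w) \in A)) => // /(in_sub _ _ _ zC)/andP[->].
  have /andP[wz zw] := out_sub _ _ _ zC (A_refl z).
  rewrite /M wz; case: (boolP ((z, w) \in A)) => [|_]; last by rewrite subr0.
  by move=> /(in_sub _ _ _ zC)/andP[_]; rewrite eqxx.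
(* Since the [B]-in-neighbours of [w] are [w] and the non-out-neighbours of [w]
   in [A], this rearranges [nonC_mass]. *)
have in_ineq w : \sum_v p v * ((v, w) \in A)%:R + \sum_v p v * ((v, w) \in B)%:R - p w
    <= \sum_v p v * ((v, w) \in C)%:R.
  have -> : p w = \sum_v p v * (v == w)%:R.
    rewrite (bigD1 w)//= eqxx mulr1 big1 ?addr0// => v /negPf->.
    by rewrite mulr0.
  rewrite -big_split -sumrB/= -subr_ge0 -sumrB.
  have := nonC_mass w; rewrite -subr_ge0 [X in _ - X]big_mkcond -sumrB.
  congr (0 <= _); apply: eq_bigr => v _; rewrite BE /M.
  case: (eqVneq v w) => [->|_]; last first.
    by case: (_ \in C); case: (_ \in A); case: (_ \in A) => /=; ring.
  by rewrite !A_refl; case: (_ \in C) => /=; ring.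
have [v] : exists v, 0 <= weight omega (dg_out C v)
    - (weight omega (dg_out A v) + weight omega (dg_out B v) - omega v).
  apply: (exists_ge0_of_weighted_sum p_ge0 p_gt0).
  have -> : \sum_v p v * (weight omega (dg_out C v)
      - (weight omega (dg_out A v) + weight omega (dg_out B v) - omega v))
    = \sum_v p v * weight omega (dg_out C v)
      - (\sum_v p v * weight omega (dg_out A v)
         + \sum_v p v * weight omega (dg_out B v) - \sum_v omega v * p v).
    rewrite -big_split -!sumrB/=; apply: eq_bigr => v _; ring.
  rewrite !sum_weight_out subr_ge0 -big_split -sumrB/=.
  apply: ler_sum => w _; rewrite -mulrDr -mulrBr.
  exact: ler_wpM2l.
by rewrite subr_ge0 => ?; exists v.
Qed.
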